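(* Let $\bar\gamma_M>0$, $\bar\gamma_E>0$ and $0\le\rho<1$, and let $(H_M,H_E)$ be nonnegative random variables with joint density $$f_{H_M,H_E}(h_M,h_E)=\frac{1}{\bar\gamma_M\bar\gamma_E(1-\rho)}\exp\!\left[-\frac{1}{1-\rho}\left(\frac{h_M}{\bar\gamma_M}+\frac{h_E}{\bar\gamma_E}\right)\right]I_0\!\left(\frac{2}{1-\rho}\sqrt{\frac{\rho\,h_M h_E}{\bar\gamma_M\bar\gamma_E}}\right),\qquad h_M,h_E\ge 0,$$ where $I_0(x)=\frac{1}{2\pi}\int_0^{2\pi}e^{x\cos\theta}\,d\theta$, and let $\kappa=\bar\gamma_M/\bar\gamma_E$. For $\bar P>0$ define the secrecy capacity $$C_s(\bar P)=\sup_{P}\ \mathbb{E}\Big[\big(\log(1+H_MP(H_M,H_E))-\log(1+H_EP(H_M,H_E))\big)\mathbf{1}\{H_M>H_E\}\Big],$$ the supremum being over measurable power allocations $P:[0,\infty)^2\to[0,\infty)$ with $\mathbb{E}[P(H_M,H_E)]\le\bar P$. Then, as $\bar P\to\infty$ (i.e. as the SNR grows), $C_s(\bar P)$ converges to the limiting value $$C_s^{\lim}(\kappa,\rho)=\mathbb{E}\!\left[\log\!\frac{H_M}{H_E}\,\mathbf{1}\{H_M>H_E\}\right]=\log(1+\kappa)+\log\!\left(\frac12+\sqrt{\frac14-\frac{\rho\kappa}{(1+\kappa)^2}}\right).$$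
   Context: $H_M$ and $H_E$ are the fading power gains of the main (legitimate) channel and the eavesdropper channel in an ergodic fading wiretap channel with unit-variance Gaussian noise and full channel state information at the transmitter; the given joint density is the correlated (bivariate) Rayleigh model, with exponential marginals of means $\bar\gamma_M,\bar\gamma_E$ and power correlation coefficient $\rho$. $\kappa$ is the average channel gain ratio. The logarithm is taken in a fixed base throughout. *)

(* Defs.v *)
From HB Require Import structures.
From mathcomp Require Import all_boot all_order all_algebra.
From mathcomp Require Import all_classical all_reals all_analysis.
Set Implicit Arguments. Unset Strict Implicit. Unset Printing Implicit Defensive.
Import Order.TTheory GRing.Theory Num.Theory numFieldNormedType.Exports.
Local Open Scope classical_set_scope.
Local Open Scope ring_scope.

Section defs.
Variable R : realType.

Definition besselI0 (x : R) : R :=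
  (2 * pi)^-1 * Rintegral (@lebesgue_measure R) `[0, 2 * pi]
                          (fun t => expR (x * cos t)).

Definition logb (b x : R) : R := ln x / ln b.

(* correlated bivariate Rayleigh (power) joint density; h = (h_M, h_E) *)
Definition corr_pdf (gM gE rho : R) (h : R * R) : R :=
  (gM * gE * (1 - rho))^-1
  * expR (- ((1 - rho)^-1 * (h.1 / gM + h.2 / gE)))
  * besselI0 (2 / (1 - rho) * Num.sqrt (rho * h.1 * h.2 / (gM * gE))).

Definition quadrant : set (R * R) := `[0, +oo[ `*` `[0, +oo[.

Definition expect (gM gE rho : R) (g : R * R -> R) : \bar R :=
  (\int[((@lebesgue_measure R) \x (@lebesgue_measure R))%E]_(h in quadrant)
     (g h * corr_pdf gM gE rho h)%:E)%E.

Definition secrecy_rate (b : R) (P : R * R -> R) (h : R * R) : R :=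
  if h.2 < h.1 then logb b (1 + h.1 * P h) - logb b (1 + h.2 * P h) else 0.

Definition admissible (gM gE rho Pbar : R) (P : R * R -> R) : Prop :=
  measurable_fun setT P /\ (forall h, 0 <= P h) /\
  (expect gM gE rho P <= Pbar%:E)%E.

Definition secrecy_capacity (b gM gE rho Pbar : R) : \bar R :=
  ereal_sup [set expect gM gE rho (secrecy_rate b P) |
             P in admissible gM gE rho Pbar].

Definition lim_integrand (b : R) (h : R * R) : R :=
  if h.2 < h.1 then logb b (h.1 / h.2) else 0.

End defs.

(* Main.v *)
Require Import Defs.
From HB Require Import structures.
From mathcomp Require Import all_boot all_order all_algebra.
From mathcomp Require Import all_classical all_reals all_analysis.
From mathcomp Require Import measurable_realfun ring lra.
Import Order.TTheory GRing.Theory Num.Theory numFieldNormedType.Exports.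
Local Open Scope classical_set_scope.
Local Open Scope ring_scope.

(* Where [h_M > h_E > 0], the ratio [(1 + h_M p) / (1 + h_E p)] increases with
   [p] to [h_M / h_E]. So no allocation beats the limit, and constant
   allocations reach it by monotone convergence; they are admissible because
   the density has total mass 1.
   For the closed form, put [a = gE], [c = gM]. Substituting [h_M = t h_E] and
   replacing [I_0] by its integral representation, Tonelli reduces the density
   of [t = h_M / h_E] to [int y exp(-(A - B cos x) y) dy = (A - B cos x)^-2] and
   [int_0^2pi (A - B cos x)^-2 dx = 2 pi A / (A^2 - B^2)^(3/2)], that is, to
   [a c (1 - rho) (a t + c) / D^(3/2)] with [D = (a t + c)^2 - 4 rho a c t].
   This is the derivative of [(a t - c) / (2 sqrt D)], and
   [ln t - G(t) ln t - ln (a t + c + sqrt D)], where [G] is the tail of the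
   law of [t], is an antiderivative of [ln t] times the density. *)

(** * Integrals on segments and half-lines from explicit antiderivatives *)

Section calculus.
Context {R : realType}.
Implicit Types (f F : R -> R) (a b c l t x : R).
Local Notation mu := (@lebesgue_measure R).

(** Also serves to prove continuity of explicit expressions: instance resolution for [is_derive]
    finds some derivative [df], whose value does not matter. *)
Lemma is_derive_continuous f x (df : R) :
  is_derive x 1 f df -> {for x, continuous f}.
Proof.
by move=> h; apply/differentiable_continuous/derivable1_diffP; have [] := h.
Qed.

Lemma integral_itv_is_derive f F a b : a < b ->
  (forall x, a <= x <= b -> {for x, continuous f}) ->
  (forall x, a <= x <= b -> is_derive x 1 F (f x)) ->
  (\int[mu]_(x in `[a, b]) (f x)%:E = (F b - F a)%:E)%E.
Proof.
move=> ab cf dF.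
have cF x : a <= x <= b -> {for x, continuous F}.
  by move=> /dF; exact: is_derive_continuous.
rewrite EFinB; apply: continuous_FTC2 => //.
- apply: continuous_in_subspaceT => x /set_mem /=.
  by rewrite in_itv/=; exact: cf.
- split.
  + move=> x; rewrite in_itv/= => /andP[ax xb].
    have := dF x; rewrite (ltW ax) (ltW xb) => /(_ isT) h; exact: ex_derive.
  + by apply: cvg_at_right_filter; apply: cF; rewrite lexx ltW.
  + by apply: cvg_at_left_filter; apply: cF; rewrite lexx ltW.
- move=> x; rewrite in_itv/= => /andP[ax xb].
  rewrite derive1E; apply: derive_val.
  by apply: dF; rewrite !ltW.
Qed.

(** Nonnegativity of [f] makes the improper integral the limit of increments of [F]. *)
Lemma integral_itvy_is_derive f F a l :
  (forall x, a <= x -> 0 <= f x) ->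
  (forall x, a <= x -> {for x, continuous f}) ->
  (forall x, a <= x -> is_derive x 1 F (f x)) ->
  F x @[x --> +oo] --> l ->
  (\int[mu]_(x in `[a, +oo[) (f x)%:E = (l - F a)%:E)%E.
Proof.
move=> f0 cf dF Fl.
rewrite EFinB; apply: ge0_continuous_FTC2y => //.
- apply: continuous_in_subspaceT => x /set_mem /=.
  by rewrite in_itv/= andbT; exact: cf.
- move=> x /ltW /dF h; exact: ex_derive.
- apply: cvg_at_right_filter.
  exact: is_derive_continuous (dF a (lexx _)).
- move=> x; rewrite in_itv/= andbT => /ltW /dF h.
  by rewrite derive1E; apply: derive_val.
Qed.

End calculus.

(** * The integral of the squared Poisson kernel over a period *)

Section poisson.
Context {R : realType}.
Local Notation mu := (@lebesgue_measure R).

(** The bracket [x + 2 * atan (...)] is an antiderivative of the Poisson kernel [(1 - q ^+ 2) / (1 -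
    2 * q * cos x + q ^+ 2)], and the sine quotient corrects it to the square of the kernel. As
    [1 - q * cos x] stays positive, this form of the arctangent has no jump on the period, unlike
    the one from the half-angle substitution. *)
Lemma is_derive_poisson (m q x : R) : 0 < m -> 0 <= q < 1 ->
  is_derive x 1 (fun x : R =>
      ((1 + q ^+ 2) / (1 - q ^+ 2) *
         (x + 2 * atan (q * sin x / (1 - q * cos x)))
       + 2 * q * sin x / (1 - 2 * q * cos x + q ^+ 2)) / (m * (1 - q ^+ 2)) ^+ 2)
    ((m * (1 - 2 * q * cos x + q ^+ 2)) ^- 2).
Proof.
move=> m0 /andP[q0 q1].
have c1 := cos_le1 x; have c2 := cos_geN1 x; have cs := cos2Dsin2 x.
have S2 : sin x ^+ 2 = 1 - cos x ^+ 2 by rewrite -cs; ring.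
have e0 : 1 - q * cos x != 0 by rewrite gt_eqF//; nra.
have n0 : 1 - 2 * q * cos x + q ^+ 2 != 0 by rewrite gt_eqF//; nra.
have q2 : 1 - q ^+ 2 != 0 by rewrite gt_eqF//; nra.
have h1 : is_derive x 1 (fun x : R => q * sin x / (1 - q * cos x)) 
    ((q * cos x - q ^+ 2) / (1 - q * cos x) ^+ 2).
  apply: is_derive_eq; rewrite /GRing.scale/=.
  field: S2.
  by [].
have h2 : is_derive x 1 (fun x : R => atan (q * sin x / (1 - q * cos x))) 
    ((q * cos x - q ^+ 2) / (1 - 2 * q * cos x + q ^+ 2)).
  apply: is_derive_eq.
  have -> : 1 + (q * sin x / (1 - q * cos x)) ^+ 2 =
      (1 - 2 * q * cos x + q ^+ 2) / (1 - q * cos x) ^+ 2.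
    field: S2; by [].
  field.
  by rewrite e0 n0.
apply: is_derive_eq; rewrite /GRing.scale/=.
field: S2.
by rewrite n0 q2 gt_eqF.
Qed.

(** The sine vanishes at both ends of the period, so only the linear term [x] of the antiderivative
    contributes. *)
Lemma integral_poisson (m q : R) : 0 < m -> 0 <= q < 1 ->
  (\int[mu]_(x in `[0%R, (2 * pi)%R]) ((m * (1 - 2 * q * cos x + q ^+ 2)) ^- 2)%:E
   = (2 * pi * (1 + q ^+ 2) / (m ^+ 2 * (1 - q ^+ 2) ^+ 3))%:E)%E.
Proof.
move=> m0 /andP[q0 q1]; have pi0 := @pi_gt0 R.
have q2 : 1 - q ^+ 2 != 0 by rewrite gt_eqF//; nra.
rewrite (@integral_itv_is_derive _ _ _ _ _ _ _
  (fun x _ => is_derive_poisson m q x m0 _)).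
- congr EFin; rewrite sin0 (_ : sin (2 * pi) = 0) ?mulr0 ?mul0r ?atan0; last first.
    by rewrite mulr2n mulrDl mul1r sinD sinpi mul0r mulr0 addr0.
  field.
  by rewrite q2 gt_eqF.
- by rewrite mulr_gt0.
- move=> x _; have c1 := cos_le1 x; have c2 := cos_geN1 x.
  have n0 : (m * (1 - 2 * q * cos x + q ^+ 2)) ^+ 2 != 0.
    by rewrite expf_neq0// gt_eqF// mulr_gt0//; nra.
  exact: is_derive_continuous.
- by rewrite q0 q1.
Qed.

(* The kernel (A - B cos x)^-2 becomes a Poisson kernel squared for
   [q = B / (A + w)]: then [A = m (1 + q^2)], [B = 2 m q], [w = m (1 - q^2)]. *)
Lemma integral_inv_sqr_cos (A B : R) : 0 <= B < A ->
  (\int[mu]_(x in `[0%R, (2 * pi)%R]) ((A - B * cos x) ^- 2)%:E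
   = (2 * pi * (A / Num.sqrt (A ^+ 2 - B ^+ 2) ^+ 3))%:E)%E.
Proof.
move=> /andP[B0 BA]; set w := Num.sqrt _.
have w2 : w ^+ 2 = A ^+ 2 - B ^+ 2 by rewrite sqr_sqrtr//; nra.
have w0 : 0 < w by rewrite sqrtr_gt0; nra.
have Aw : A + w != 0 by rewrite gt_eqF//; lra.
pose q := B / (A + w); pose m := (A + w) / 2.
have q1 : q < 1 by rewrite ltr_pdivrMr; lra.
have q0 : 0 <= q by rewrite divr_ge0; lra.
have B2 : B ^+ 2 = A ^+ 2 - w ^+ 2 by rewrite w2; ring.
have mA : m * (1 + q ^+ 2) = A by rewrite /m /q; field: B2.
have mB : 2 * m * q = B by rewrite /m /q; field.
have mw : m * (1 - q ^+ 2) = w by rewrite /m /q; field: B2.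
have m0 : 0 < m by rewrite divr_gt0//; lra.
have kE x : A - B * cos x = m * (1 - 2 * q * cos x + q ^+ 2).
  by rewrite -mA -mB; ring.
under eq_integral do rewrite kE.
rewrite integral_poisson ?q0// -mA -mw; congr EFin.
field.
by rewrite (gt_eqF m0)// andbT gt_eqF//; nra.
Qed.
End poisson.

(** * Limits at infinity and the first moment of the exponential kernel *)

Section limits.
Context {R : realType}.
Local Notation mu := (@lebesgue_measure R).

Lemma cvgy_inv : (t^-1 : R) @[t --> +oo] --> (0 : R).
Proof.
have cvgid : (id t : R) @[t --> +oo] --> +oo by exact: cvg_id.
by apply/(gtr0_cvgV0 (f := id)) => //; exact: nbhs_pinfty_gt.
Qed.

(** Squeezed under [2 / t], because [expR t] dominates [t ^+ 2 / 2]. *)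
Lemma cvgy_mul_expRN : (t * expR (- t) : R) @[t --> +oo] --> (0 : R).
Proof.
apply: (squeeze_cvgr (f := cst 0) (h := fun t : R => 2 * t^-1)).
- near=> t; have t0 : 0 < t by near: t; exact: nbhs_pinfty_gt.
  apply/andP; split; first by rewrite mulr_ge0 ?expR_ge0// ltW.
  rewrite expRN ler_pdivrMr ?expR_gt0// mulrAC ler_pdivlMr//.
  by have := expR_ge1Dxn 1 (ltW t0); rewrite (_ : 2`! = 2)%N// => h; nra.
- exact: cvg_cst.
- rewrite -[X in _ --> X](mulr0 2); apply: cvgM; [exact: cvg_cst|exact: cvgy_inv].
Unshelve. all: by end_near. Qed.

(** [ln t] is twice the logarithm of [Num.sqrt t], hence below [2 * Num.sqrt t]; the quotient is
    under [e] once [t] exceeds [(2 / e) ^+ 2]. *)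
Lemma cvgy_ln_div : (ln t / t : R) @[t --> +oo] --> (0 : R).
Proof.
apply/cvgrPdist_lt => e e0; near=> t.
have t1 : 1 < t by near: t; exact: nbhs_pinfty_gt.
have te : (2 / e) ^+ 2 < t.
  by near: t; apply: nbhs_pinfty_gt; exact: num_real.
have t0 : 0 < t by lra.
have s0 : 0 < Num.sqrt t by rewrite sqrtr_gt0.
have st : Num.sqrt t ^+ 2 = t by rewrite sqr_sqrtr// ltW.
rewrite sub0r normrN ger0_norm; last first.
  by apply: divr_ge0; [apply: ln_ge0|]; exact: ltW.
rewrite ltr_pdivrMr// -{1}st lnXn// -[X in _ < e * X]st.
have lns := ln_sublinear s0.
have es : 2 < e * Num.sqrt t.
  rewrite mulrC -ltr_pdivrMr// -(ltr_pXn2r (_ : (0 < 2)%N)) ?nnegrE// ?st// ltW//.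
  by rewrite divr_gt0.
rewrite mulr2n; nra.
Unshelve. all: by end_near. Qed.

Lemma integral_mul_expR (r : R) : 0 < r ->
  (\int[mu]_(y in `[0%R, +oo[) (y * expR (- (r * y)))%:E = (r ^- 2)%:E)%E.
Proof.
move=> r0.
(* This function is the antiderivative; unification with [cvg0] supplies it below. *)
have cvg0 : (- (r * y + 1) * expR (- (r * y)) / r ^+ 2) @[y --> +oo] --> 0.
  have cvgry : (r * y) @[y --> +oo] --> +oo.
    by apply/gt0_cvgMry => //; exact: cvg_id.
  have -> : (fun y => - (r * y + 1) * expR (- (r * y)) / r ^+ 2) =
     (fun z => - (z * expR (- z) + expR (- z)) / r ^+ 2) \o ( *%R r).
    by apply/funext => y /=; congr (_ / _); ring.
  apply: cvg_comp cvgry _.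
  rewrite (_ : (0 : R) = - (0 + 0) / r ^+ 2); last by rewrite addr0 oppr0 mul0r.
  apply: cvgM; last exact: cvg_cst.
  by apply: cvgN; apply: cvgD; [exact: cvgy_mul_expRN|exact: cvgr_expR].
rewrite (integral_itvy_is_derive _ _ _ _ _ _ _ cvg0).
- congr EFin; rewrite mulr0 oppr0 expR0; by field; rewrite gt_eqF.
- by move=> y y0; rewrite mulr_ge0// expR_ge0.
- move=> y _; exact: is_derive_continuous.
- move=> y _; apply: is_derive_eq; rewrite /GRing.scale/=.
  by field; rewrite gt_eqF.
Qed.
End limits.

(** * Tonelli on product sets and the Laplace-type integral of [besselI0] *)

Section bessel.
Context {R : realType}.
Local Notation mu := (@lebesgue_measure R).

Section tonelli.
Variables (D1 D2 : set R) (f : R * R -> \bar R).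
Hypotheses (mD1 : measurable D1) (mD2 : measurable D2).
Hypothesis mf : measurable_fun (D1 `*` D2 : set (R * R)) f.
Hypothesis f0 : forall z, (D1 `*` D2) z -> (0 <= f z)%E.

Let mD : measurable (D1 `*` D2). Proof. exact: measurableX. Qed.

Let mfD : measurable_fun setT (f \_ (D1 `*` D2)).
Proof. exact/(measurable_restrictT _ _).1. Qed.

Let fD0 z : (0 <= (f \_ (D1 `*` D2)) z)%E. Proof. exact: erestrict_ge0. Qed.

(** Extend [f] by zero to the whole plane and apply Tonelli there; the inner integral vanishes for
    [x] outside [D1]. *)
Lemma fubini_tonelli1_setX :
  (\int[mu \x mu]_(z in D1 `*` D2) f z =
   \int[mu]_(x in D1) \int[mu]_(y in D2) f (x, y))%E.
Proof.
rewrite [LHS]integral_mkcond [RHS]integral_mkcond.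
transitivity (\int[mu]_x fubini_F mu (f \_ (D1 `*` D2)) x)%E.
  exact: fubini_tonelli1.
apply: eq_integral => x _; rewrite /fubini_F patchE.
case: ifPn => xD.
  rewrite [RHS]integral_mkcond; apply: eq_integral => y _.
  rewrite !patchE; congr (if _ then _ else _).
  apply/idP/idP => /set_mem h; apply/mem_set => //=; first by case: h.
  by split=> //; exact/set_mem.
apply: integral0_eq => y _; rewrite patchE ifF//.
by apply/negbTE; apply: contra xD => /set_mem[h _]; exact/mem_set.
Qed.

Lemma fubini_tonelli2_setX :
  (\int[mu \x mu]_(z in D1 `*` D2) f z =
   \int[mu]_(y in D2) \int[mu]_(x in D1) f (x, y))%E.
Proof.
rewrite [LHS]integral_mkcond [RHS]integral_mkcond.
transitivity (\int[mu]_x fubini_G mu (f \_ (D1 `*` D2)) x)%E.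
  exact: fubini_tonelli2.
apply: eq_integral => y _; rewrite /fubini_G patchE.
case: ifPn => yD.
  rewrite [RHS]integral_mkcond; apply: eq_integral => x _.
  rewrite !patchE; congr (if _ then _ else _).
  apply/idP/idP => /set_mem h; apply/mem_set => //=; first by case: h.
  by split=> //; exact/set_mem.
apply: integral0_eq => x _; rewrite patchE ifF//.
by apply/negbTE; apply: contra yD => /set_mem[_ h]; exact/mem_set.
Qed.

End tonelli.

Let K : set R := `[0, (2 * pi)%R].

(** [besselI0] is built on a real-valued integral, whereas Tonelli works with extended reals. The
    two agree because a continuous function on a segment has a finite integral. *)
Lemma integral_expR_cos (x : R) :
  (\int[mu]_(t in K) (expR (x * cos t))%:E = (2 * pi * besselI0 x)%:E)%E.
Proof.
have pi2 : 2 * pi != 0 :> R by rewrite gt_eqF// mulr_gt0// pi_gt0.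
rewrite mulrA divff// mul1r fineK//; apply: integrable_fin_num => //.
apply: continuous_compact_integrable; first exact: segment_compact.
apply: continuous_subspaceT => t.
exact: is_derive_continuous.
Qed.

Lemma besselI0_ge0 (x : R) : 0 <= besselI0 x.
Proof.
rewrite mulr_ge0 ?invr_ge0 ?mulr_ge0 ?pi_ge0//.
by apply: Rintegral_ge0 => //= t _; exact: expR_ge0.
Qed.

(** Up to a constant this is a partial integral of a nonnegative function measurable in both
    variables, so Tonelli gives its measurability. *)
Lemma measurable_besselI0 : measurable_fun setT (@besselI0 R).
Proof.
have pi2 : 2 * pi != 0 :> R by rewrite gt_eqF// mulr_gt0// pi_gt0.
have -> : @besselI0 R = fun x => (2 * pi)^-1 * (2 * pi * besselI0 x).
  by apply/funext => x; rewrite mulrA mulVf// mul1r.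
apply: measurable_funM => //; apply/measurable_EFinP.
rewrite (_ : _ \o _ =
  fun x => \int[mu]_(t in K) (expR (x * cos t))%:E)%E; last first.
  by apply/funext => x; rewrite /= integral_expR_cos.
pose g := (fun z : R * R => (expR (z.1 * cos z.2))%:E) \_ (setT `*` K).
rewrite (_ : (fun x => _) = fun x => \int[mu]_t g (x, t))%E; last first.
  apply/funext => x; rewrite integral_mkcond; apply: eq_integral => t _.
  rewrite /g !patchE; congr (if _ then _ else _).
  by apply/idP/idP => /set_mem h; apply/mem_set => //=; case: h.
apply: (@measurable_fun_fubini_tonelli_F _ _ _ _ R mu g).
- apply/(measurable_restrictT _ _).1.
    by apply: measurableX; [exact: measurableT|exact: measurable_itv].
  apply/measurable_funTS/measurable_EFinP/measurableT_comp => //.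
  apply: measurable_funM => //.
  apply: measurableT_comp => //.
  apply: continuous_measurable_fun; exact: continuous_cos.
- by move=> z; apply: erestrict_ge0 => t _; rewrite lee_fin expR_ge0.
Qed.

Lemma integral_mul_expR_besselI0 (A B : R) : 0 <= B < A ->
  (\int[mu]_(y in `[0%R, +oo[) (y * expR (- (A * y)) * besselI0 (B * y))%:E =
   (A / Num.sqrt (A ^+ 2 - B ^+ 2) ^+ 3)%:E)%E.
Proof.
move=> /andP[B0 BA].
have pi2 : 0 < 2 * pi :> R by rewrite mulr_gt0// pi_gt0.
have mcos : measurable_fun setT (@cos R).
  by apply: continuous_measurable_fun; exact: continuous_cos.
have mK : measurable K by exact: measurable_itv.
pose u (y : R) := y * expR (- (A * y)) * besselI0 (B * y).
pose h (z : R * R) := (z.1 * expR (- ((A - B * cos z.2) * z.1)))%:E.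
have mh : measurable_fun setT h.
  apply/measurable_EFinP; apply: measurable_funM => //.
  apply: measurableT_comp => //; apply: measurableT_comp => //.
  apply: measurable_funM => //; apply: measurable_funB => //.
  by apply: measurable_funM => //; exact: measurableT_comp.
have h0 z : (`[0%R, +oo[ `*` K) z -> (0 <= h z)%E.
  move=> [/=]; rewrite in_itv/= andbT => z0 _.
  by rewrite lee_fin mulr_ge0// expR_ge0.
have hE y : 0 <= y -> (\int[mu]_(t in K) h (y, t) = (2 * pi)%:E * (u y)%:E)%E.
  move=> y0.
  rewrite -EFinM (_ : _ * u y =
    y * expR (- (A * y)) * (2 * pi * besselI0 (B * y))); last first.
    by rewrite /u; ring.
  rewrite EFinM -integral_expR_cos.
  rewrite -ge0_integralZl_EFin; last 4 first.
  - exact: measurable_itv.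
  - by move=> t _; rewrite lee_fin expR_ge0.
  - apply/measurable_EFinP/measurable_funTS/measurableT_comp => //.
    exact: measurable_funM.
  - by rewrite mulr_ge0// expR_ge0.
  apply: eq_integral => t _; rewrite -EFinM; congr EFin.
  by rewrite /= -[RHS]mulrA -expRD; congr (_ * expR _); ring.
have umeas : measurable_fun setT u.
  apply: measurable_funM; last first.
    apply: measurableT_comp; first exact: measurable_besselI0.
    exact: measurable_funM.
  apply: measurable_funM => //; apply: measurableT_comp => //.
  apply: measurableT_comp => //; exact: measurable_funM.
(* The factor [2 * pi] cancels the normalisation of [besselI0], leaving a plain double integral over
   [y] and the angle. There [B < A] keeps the rate [A - B * cos t] positive. *)
have : ((2 * pi)%:E * \int[mu]_(y in `[0%R, +oo[) (u y)%:E =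
        (2 * pi)%:E * (A / Num.sqrt (A ^+ 2 - B ^+ 2) ^+ 3)%:E)%E.
  rewrite -EFinM -integral_inv_sqr_cos ?B0// -ge0_integralZl_EFin//; last 3 first.
  - move=> y /=; rewrite in_itv/= andbT => y0.
    by rewrite lee_fin mulr_ge0 ?besselI0_ge0// mulr_ge0// expR_ge0.
  - exact/measurable_EFinP/measurable_funTS.
  - exact: ltW.
  transitivity (\int[mu]_(y in `[0%R, +oo[) \int[mu]_(t in K) h (y, t))%E.
    apply: eq_integral => y; rewrite inE/= in_itv/= andbT => y0.
    by rewrite hE.
  rewrite -fubini_tonelli1_setX//; last exact: measurable_funTS.
  rewrite fubini_tonelli2_setX//; last exact: measurable_funTS.
  apply: eq_integral => t _.
  have AB0 : 0 < A - B * cos t by have := cos_le1 t; nra.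
  exact: integral_mul_expR AB0.
move=> h2pi; have := congr1 (fun z => (2 * pi)^-1%:E * z)%E h2pi.
by rewrite !muleA -EFinM mulVf ?gt_eqF// !mul1e.
Qed.

End bessel.

(** * Linear change of variable on the half-line *)

Section scaling.
Context {R : realType}.
Local Notation mu := (@lebesgue_measure R).
Variables (c : R) (c0 : 0 < c).

Let cmul : measurableTypeR R -> measurableTypeR R := *%R c.

Let mcmul : measurable_fun setT cmul.
Proof. exact: (@measurable_funM _ (measurableTypeR R)). Qed.

Let nu : {measure set (measurableTypeR R) -> \bar R} :=
  measure_function_pushforward__canonical__measure_function_Measure mu mcmul.
Let cnu : {measure set (measurableTypeR R) -> \bar R} :=
  mscale (NngNum (ltW c0)) nu.

(** By uniqueness of Lebesgue measure it suffices to look at half-open intervals: the preimage under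
    multiplication by [c] is shorter by the factor [c], which the scaling of [nu] restores. *)
Let cnuE (A : set R) : measurable A ->
  cnu A = mu A.
Proof.
move=> mA; apply/esym/lebesgue_measure_unique => //= _ [[a b]] _ <-.
rewrite /cnu /= /mscale/= /pushforward.
rewrite (_ : _ @^-1` _ = `]a / c, b / c]%classic); last first.
  apply/seteqP; split => x /=; rewrite !in_itv/= ltr_pdivrMr// ler_pdivlMr//;
  by rewrite (mulrC x).
rewrite !lebesgue_measure_itv/= !lte_fin ltr_pM2r ?invr_gt0//.
case: ifPn => _; last by rewrite mule0.
by rewrite -!EFinD -EFinM -mulrBl mulrC divfK// gt_eqF.
Qed.

Lemma ge0_integral_scale (f : R -> \bar R) :
  measurable_fun (`[0%R, +oo[%classic : set R) f ->
  (forall x, 0 <= x -> (0 <= f x)%E) ->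
  (\int[mu]_(x in `[0%R, +oo[) f x =
   c%:E * \int[mu]_(x in `[0%R, +oo[) f (c * x)%R)%E.
Proof.
move=> mf f0.
have f0' (x : R) : `[0%R, +oo[%classic x -> (0 <= f x)%E.
  by rewrite /= in_itv/= andbT => /f0.
transitivity (\int[cnu]_(x in `[0%R, +oo[) f x)%E.
  by apply: eq_measure_integral => A mA _; exact/esym/cnuE.
rewrite /cnu ge0_integral_mscale//; congr (_ * _)%E.
rewrite ge0_integral_pushforward//; last first.
  by move=> x; rewrite inE; exact: f0'.
rewrite (_ : _ @^-1` _ = `[0%R, +oo[%classic)//.
by apply/seteqP; split => x /=; rewrite !in_itv/= !andbT /cmul pmulr_rge0.
Qed.

End scaling.

(** * Total mass and logarithmic moment of the density of the gain ratio *)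

Section ratio_calculus.
Context {R : realType}.
Local Notation mu := (@lebesgue_measure R).
Implicit Types t : R.
Variables (a c rho : R) (a0 : 0 < a) (c0 : 0 < c).
Hypotheses (rho0 : 0 <= rho) (rho1 : rho < 1).

Definition ratio_disc (t : R) : R := (a * t + c) ^+ 2 - 4 * rho * a * c * t.

Definition ratio_pdf (t : R) : R :=
  a * c * (1 - rho) * (a * t + c) / Num.sqrt (ratio_disc t) ^+ 3.

Local Notation D := ratio_disc.
Local Notation sD t := (Num.sqrt (ratio_disc t)).

(** The discriminant is the convex combination of the squares of [a * t + c] and [a * t - c] with
    weights [1 - rho] and [rho]; the first square and its weight are positive. *)
Lemma ratio_disc_gt0 t : 0 <= t -> 0 < D t.
Proof.
move=> t0; have at0 : 0 <= a * t by rewrite mulr_ge0// ltW.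
have -> : D t = (1 - rho) * (a * t + c) ^+ 2 + rho * (a * t - c) ^+ 2.
  by rewrite /ratio_disc; ring.
rewrite ltr_pwDl//; last by rewrite mulr_ge0// sqr_ge0.
by rewrite mulr_gt0 ?subr_gt0// exprn_gt0// ltr_wpDl.
Qed.

Lemma ratio_pdf_ge0 t : 0 <= t -> 0 <= ratio_pdf t.
Proof.
move=> t0; rewrite divr_ge0 ?exprn_ge0 ?sqrtr_ge0// mulr_ge0 ?addr_ge0 ?mulr_ge0//;
  rewrite ?subr_ge0; exact: ltW.
Qed.

Lemma is_derive_sqrt_disc t : 0 <= t ->
  is_derive t 1 (fun t => sD t) ((a * (a * t + c) - 2 * rho * a * c) / sD t).
Proof.
move=> t0; have Dt := ratio_disc_gt0 t t0.
have dD : is_derive t 1 ratio_disc (2 * (a * (a * t + c) - 2 * rho * a * c)).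
  by apply: is_derive_eq; rewrite /GRing.scale/=; ring.
have := @is_derive1_comp R Num.sqrt ratio_disc t _ _ (is_derive1_sqrt Dt) dD.
rewrite (_ : _ * _ = (a * (a * t + c) - 2 * rho * a * c) / sD t)//.
by field; rewrite gt_eqF ?sqrtr_gt0.
Qed.

(** The primitive is the distribution function of the ratio lowered by one half: it runs from
    [- 2^-1] at [0] to [2^-1] at infinity. *)
Lemma is_derive_ratio_cdf t : 0 <= t ->
  is_derive t 1 (fun t => (a * t - c) / sD t / 2) (ratio_pdf t).
Proof.
move=> t0; have ds := is_derive_sqrt_disc t t0.
have s0 : sD t != 0 by rewrite gt_eqF// sqrtr_gt0 ratio_disc_gt0.
have s2 : sD t ^+ 2 = (a * t + c) ^+ 2 - 4 * rho * a * c * t.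
  by rewrite sqr_sqrtr// ltW// ratio_disc_gt0.
apply: is_derive_eq; rewrite /GRing.scale/= /ratio_pdf.
by field: s2.
Qed.

Lemma continuous_ratio_pdf t : 0 <= t -> {for t, continuous ratio_pdf}.
Proof.
move=> t0; have ds := is_derive_sqrt_disc t t0.
have s0 : sD t ^+ 3 != 0 by rewrite expf_neq0// gt_eqF// sqrtr_gt0 ratio_disc_gt0.
exact: is_derive_continuous.
Qed.

(** For [t > 0] one has [sD t = t * r t^-1], so limits at infinity reduce to continuity of [r] at
    [0], where its value is [a]. *)
Let r (s : R) := Num.sqrt ((a + c * s) ^+ 2 - 4 * rho * a * c * s).

Let sqrt_discE t : 0 < t -> sD t = t * r t^-1.
Proof.
move=> t0; rewrite /r -{2}(ger0_norm (ltW t0)) -sqrtr_sqr -sqrtrM ?sqr_ge0//.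
by congr Num.sqrt; rewrite /ratio_disc; field; rewrite gt_eqF.
Qed.

Let cvgy_r : r t^-1 @[t --> +oo] --> a.
Proof.
have arE : a = r 0.
  by rewrite /r !mulr0 addr0 subr0 sqrtr_sqr ger0_norm// ltW.
have cr : {for 0, continuous r}.
  apply: (@continuous_comp _ _ _
    (fun s => (a + c * s) ^+ 2 - 4 * rho * a * c * s) Num.sqrt).
    exact: is_derive_continuous.
  exact: sqrt_continuous.
rewrite arE; exact: cvg_comp cvgy_inv cr.
Qed.

Let cvgy_lin (k : R) : (a + k * t^-1) @[t --> +oo] --> a.
Proof.
rewrite -[X in _ --> X]addr0 -(mulr0 k).
by apply: cvgD; [exact: cvg_cst|apply: cvgM; [exact: cvg_cst|exact: cvgy_inv]].
Qed.

Lemma integral_ratio_pdf :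
  (\int[mu]_(t in `[0%R, +oo[) (ratio_pdf t)%:E = 1)%E.
Proof.
rewrite (integral_itvy_is_derive _ (fun t => (a * t - c) / sD t / 2) _ 2^-1 _ _
  is_derive_ratio_cdf).
- congr EFin; rewrite /ratio_disc !mulr0 !add0r subr0.
  by rewrite sqrtr_sqr ger0_norm ?ltW//; field; rewrite gt_eqF.
- exact: ratio_pdf_ge0.
- exact: continuous_ratio_pdf.
- have cvgF : ((a + - c * t^-1) / r t^-1 / 2) @[t --> +oo] --> (2^-1 : R).
    rewrite -[X in _ --> X]mul1r -(@divff _ a) ?gt_eqF//.
    apply: cvgM; last exact: cvg_cst.
    apply: cvgM; first exact: cvgy_lin.
    by apply: cvgV cvgy_r; rewrite gt_eqF.
  apply: cvg_trans cvgF.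
  apply: near_eq_cvg; near=> t; have t0 : 0 < t by near: t; exact: nbhs_pinfty_gt.
  have rt : r t^-1 != 0.
    have := ratio_disc_gt0 t (ltW t0).
    by rewrite -sqrtr_gt0 sqrt_discE// pmulr_rgt0// => /gt_eqF ->.
  by rewrite sqrt_discE//; field; rewrite rt gt_eqF.
Unshelve. all: by end_near. Qed.

(** In the antiderivative [Phi] the product [ln t * G t] vanishes at [1] because [ln 1 = 0], and at
    infinity because [G t] decays like [1 / t]. What remains is [ln t - ln (a * t + c + sD t)],
    which tends to [- ln (2 * a)]. *)
Lemma integral_ln_ratio_pdf :
  (\int[mu]_(t in `[1%R, +oo[) (ln t * ratio_pdf t)%:E =
   (ln ((a + c + Num.sqrt ((a + c) ^+ 2 - 4 * rho * a * c)) / (2 * a)))%:E)%E.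
Proof.
pose G (t : R) : R := (1 - (a * t - c) / sD t) / 2.
pose Phi (t : R) : R := - (ln t * G t) + ln t - ln (a * t + c + sD t).
have sD0 t : 0 <= t -> 0 < sD t by move=> t0; rewrite sqrtr_gt0 ratio_disc_gt0.
have sD2 t : 0 <= t -> sD t ^+ 2 = (a * t + c) ^+ 2 - 4 * rho * a * c * t.
  by move=> t0; rewrite sqr_sqrtr// ltW// ratio_disc_gt0.
have atc t : 0 <= t -> 0 < a * t + c + sD t.
  by move=> t0; rewrite ltr_wpDl ?sD0// addr_ge0 ?mulr_ge0// ltW.
have dPhi t : 1 <= t -> is_derive t 1 Phi (ln t * ratio_pdf t).
  move=> t1; have t0 : 0 < t by lra.
  have ds := is_derive_sqrt_disc t (ltW t0).
  have dln := is_derive1_ln t0.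
  have s0 := sD0 t (ltW t0); have s2 := sD2 t (ltW t0).
  have dG : is_derive t 1 G (- ratio_pdf t).
    have -> : G = (fun t => 2^-1 - (a * t - c) / sD t / 2).
      by apply/funext => u; rewrite /G mulrBl mul1r.
    have dF := is_derive_ratio_cdf t (ltW t0).
    have := is_deriveB (is_derive_cst (2^-1 : R) t (1 : R)) dF.
    by rewrite sub0r.
  have dL : is_derive t 1 (fun t => a * t + c + sD t)
      (a + (a * (a * t + c) - 2 * rho * a * c) / sD t).
    by apply: is_derive_eq; rewrite /GRing.scale/=; ring.
  have dlnL := @is_derive1_comp R (@ln R) _ t _ _
    (is_derive1_ln (atc t (ltW t0))) dL.
  rewrite /Phi; apply: is_derive_eq; rewrite /GRing.scale/= /G.
  have L0 := atc t (ltW t0).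
  field: s2.
  by rewrite !gt_eqF.
rewrite (integral_itvy_is_derive _ Phi _ (- ln (2 * a)) _ _ dPhi).
- congr EFin; rewrite /Phi ln1 mul0r oppr0 add0r sub0r opprK addrC -ln_div ?posrE//.
  + by rewrite /ratio_disc !mulr1.
  + by rewrite mulr1 -[in X in 0 < X](mulr1 a) atc.
  + by rewrite mulr_gt0.
- move=> t t1; rewrite mulr_ge0 ?ln_ge0// ratio_pdf_ge0//; lra.
- move=> t t1; have t0 : 0 < t by lra.
  apply: continuousM; first exact: continuous_ln.
  apply: continuous_ratio_pdf; exact: ltW.
(* [Q t] is [t * G t] with [sD t - a * t] rationalised by its conjugate. It has a finite limit, so
   [ln t * G t = ln t / t * Q t] tends to zero. *)
- pose Q (t : R) := ((2 * a * c * (1 - 2 * rho) + c ^+ 2 * t^-1) / (a + r t^-1) + c)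
    / (2 * r t^-1).
  have cvgQ : Q t @[t --> +oo] -->
      ((2 * a * c * (1 - 2 * rho) + c ^+ 2 * 0) / (a + a) + c) / (2 * a).
    apply: cvgM; last first.
      apply: cvgV; first by rewrite gt_eqF// mulr_gt0.
      by apply: cvgM; [exact: cvg_cst|exact: cvgy_r].
    apply: cvgD; last exact: cvg_cst.
    apply: cvgM; last first.
      apply: cvgV; first by rewrite gt_eqF// addr_gt0.
      by apply: cvgD; [exact: cvg_cst|exact: cvgy_r].
    apply: cvgD; first exact: cvg_cst.
    by apply: cvgM; [exact: cvg_cst|exact: cvgy_inv].
  have cvgPhi : (- (ln t / t * Q t) - ln (a + c * t^-1 + r t^-1)) @[t --> +oo] -->
      - ln (2 * a).
    rewrite -[X in _ --> X]add0r -[X in _ --> X - _]oppr0.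
    rewrite -(mul0r
      (((2 * a * c * (1 - 2 * rho) + c ^+ 2 * 0) / (a + a) + c) / (2 * a))).
    apply: cvgB; first by apply: cvgN; apply: cvgM cvgQ; exact: cvgy_ln_div.
    have cL : (a + c * t^-1 + r t^-1) @[t --> +oo] --> 2 * a.
      by rewrite mulr2n mulrDl mul1r; apply: cvgD; [exact: cvgy_lin|exact: cvgy_r].
    by apply: cvg_comp cL _; apply: continuous_ln; rewrite mulr_gt0.
  apply: cvg_trans cvgPhi.
  apply: near_eq_cvg; near=> t; have t0 : 0 < t by near: t; exact: nbhs_pinfty_gt.
  have s0 := sD0 t (ltW t0); have s2 := sD2 t (ltW t0).
  have rE : r t^-1 = sD t / t by rewrite sqrt_discE//; field; rewrite gt_eqF.
  have GE : G t = t^-1 * Q t.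
    rewrite /G /Q rE; field: s2.
    by rewrite !gt_eqF// addr_gt0// mulr_gt0.
  have LE : a * t + c + sD t = t * (a + c * t^-1 + r t^-1).
    by rewrite rE; field; rewrite gt_eqF.
  have L0 : 0 < a + c * t^-1 + r t^-1.
    by rewrite -(pmulr_rgt0 _ t0) -LE atc// ltW.
  by rewrite /Phi GE LE lnM ?posrE//; ring.
Unshelve. all: by end_near. Qed.

End ratio_calculus.

(** * Reduction of expectations of functions of the ratio to one dimension *)

Section ratio_law.
Context {R : realType}.
Local Notation mu := (@lebesgue_measure R).
Variables (gM gE rho : R).
Hypotheses (gM0 : 0 < gM) (gE0 : 0 < gE) (rho0 : 0 <= rho) (rho1 : rho < 1).
Local Notation pdf := (corr_pdf gM gE rho).
Local Notation pos := (`]0%R, +oo[%classic : set R).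
Local Notation nng := (`[0%R, +oo[%classic : set R).

Lemma corr_pdf_ge0 h : 0 <= pdf h.
Proof.
rewrite mulr_ge0 ?besselI0_ge0// mulr_ge0 ?expR_ge0// invr_ge0.
by rewrite !mulr_ge0// ?subr_ge0; exact: ltW.
Qed.

Lemma measurable_corr_pdf : measurable_fun setT pdf.
Proof.
have msqrt : measurable_fun setT (@Num.sqrt R).
  by apply: continuous_measurable_fun; exact: sqrt_continuous.
apply: measurable_funM.
  apply: measurable_funM => //; apply: measurableT_comp => //.
  apply: measurableT_comp => //; apply: measurable_funM => //.
  by apply: measurable_funD; apply: measurable_funM.
apply: measurableT_comp; first exact: measurable_besselI0.
apply: measurable_funM => //; apply: measurableT_comp => //.
apply: measurable_funM => //; apply: measurable_funM => //.
exact: measurable_funM.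
Qed.

Lemma measurable_quadrant : measurable (@quadrant R).
Proof. by apply: measurableX; exact: measurable_itv. Qed.

Lemma measurable_nng_pos : measurable (nng `*` pos).
Proof. by apply: measurableX; exact: measurable_itv. Qed.

Lemma nng_pos_quadrant : nng `*` pos `<=` @quadrant R.
Proof. by move=> [x y] []/=; rewrite /quadrant/= !in_itv/= !andbT => ? /ltW. Qed.

(* The axis [h.2 = 0], where [x / 0 = 0] and [ln 0 = 0] give junk values, is
   negligible. *)
Lemma expect_nng_pos (G : R * R -> R) : measurable_fun (@quadrant R) G ->
  (forall h, quadrant h -> 0 <= G h) ->
  expect gM gE rho G =
  (\int[mu \x mu]_(h in nng `*` pos) (G h * pdf h)%:E)%E.
Proof.
move=> mG G0; rewrite /expect.
have mN : measurable (setT `*` [set 0%R] : set (R * R)) by exact: measurableX.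
etransitivity.
  apply: (@ge0_negligible_integral _ _ _ (mu \x mu)%E _ (setT `*` [set 0%R])) => //.
  - exact: measurable_quadrant.
  - apply/measurable_EFinP/measurable_funM => //.
    by apply: measurable_funTS; exact: measurable_corr_pdf.
  - by move=> h Qh; rewrite lee_fin mulr_ge0 ?G0 ?corr_pdf_ge0.
  - transitivity (mu setT * mu [set 0%R])%E; first exact: product_measure1E.
    by rewrite lebesgue_measure_set1 mule0.
congr (integral _ _ _); apply/seteqP; split => -[x y];
  rewrite /quadrant/= !in_itv/= !andbT.
  move=> [[x0 y0] yN]; split => //; rewrite lt_neqAle y0 andbT eq_sym.
  by apply/eqP => y00; apply: yN.
move=> [x0 y0]; split; first by split => //; exact: ltW.
by case=> _ y00; move: y0; rewrite y00 ltxx.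
Qed.

Let A (t : R) := (1 - rho)^-1 * (t / gM + gE^-1).
Let B (t : R) := 2 / (1 - rho) * Num.sqrt (rho * t / (gM * gE)).

Let rho1' : 0 < 1 - rho. Proof. by rewrite subr_gt0. Qed.

(** Along a ray both the exponent and the Bessel argument are linear in [y]; for the latter,
    [y >= 0] lets [y] be pulled out of the square root. *)
Lemma corr_pdf_ray t y : 0 <= y ->
  pdf (y * t, y) =
  (gM * gE * (1 - rho))^-1 * expR (- (A t * y)) * besselI0 (B t * y).
Proof.
move=> y0; rewrite /corr_pdf/=; congr (_ * expR _ * besselI0 _).
  by rewrite /A; field; rewrite !gt_eqF.
rewrite /B -[RHS]mulrA; congr (_ * _).
rewrite -[in RHS](ger0_norm y0) -sqrtr_sqr [RHS]mulrC -sqrtrM ?sqr_ge0//.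
by congr Num.sqrt; field; rewrite !gt_eqF.
Qed.

Let B2 t : 0 <= t -> B t ^+ 2 = (2 / (1 - rho)) ^+ 2 * (rho * t / (gM * gE)).
Proof.
move=> t0; rewrite exprMn sqr_sqrtr//.
by rewrite divr_ge0 ?mulr_ge0// ltW.
Qed.

(** [A t ^+ 2 - B t ^+ 2] is [ratio_disc gE gM rho t] up to a positive factor, and the discriminant
    is positive. *)
Let BA t : 0 <= t -> 0 <= B t < A t.
Proof.
move=> t0; have B0 : 0 <= B t by rewrite mulr_ge0 ?sqrtr_ge0// divr_ge0// ltW.
have A0 : 0 < A t.
  by rewrite mulr_gt0 ?invr_gt0// ltr_wpDl ?invr_gt0// divr_ge0// ltW.
rewrite B0/= -(ltr_pXn2r (_ : (0 < 2)%N)) ?nnegrE ?(ltW A0)// -subr_gt0.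
rewrite (_ : _ - _ = ratio_disc gE gM rho t / (gM * gE * (1 - rho)) ^+ 2).
  by rewrite divr_gt0 ?exprn_gt0 ?mulr_gt0// ratio_disc_gt0.
by rewrite B2// /A /ratio_disc; field; rewrite !gt_eqF.
Qed.

Let ratio_pdfE t : 0 <= t ->
  (gM * gE * (1 - rho))^-1 * (A t / Num.sqrt (A t ^+ 2 - B t ^+ 2) ^+ 3) =
  ratio_pdf gE gM rho t.
Proof.
move=> t0; set m := gM * gE * (1 - rho).
have m0 : 0 < m by rewrite !mulr_gt0.
have D0 := ratio_disc_gt0 gE gM rho gE0 gM0 rho0 rho1 t t0.
have -> : A t ^+ 2 - B t ^+ 2 = ratio_disc gE gM rho t / m ^+ 2.
  by rewrite B2// /A /ratio_disc /m; field; rewrite !gt_eqF.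
rewrite sqrtrM ?ltW// sqrtrV ?sqr_ge0// sqrtr_sqr ger0_norm ?ltW//.
rewrite /ratio_pdf /A /m; field.
by rewrite !gt_eqF ?sqrtr_gt0.
Qed.

(** The substitution [(x, y) = (y * t, y)] has Jacobian [y], which supplies the weight [y] of the
    Bessel integral. The relation between [G] and [g] is asked for [y > 0], where the ratio is
    meaningful; the axis has measure zero. *)
Lemma expect_ratio (G : R * R -> R) (g : R -> R) :
  measurable_fun (@quadrant R) G -> (forall h, quadrant h -> 0 <= G h) ->
  measurable_fun setT g -> (forall t, 0 <= t -> 0 <= g t) ->
  (forall x y, 0 <= x -> 0 < y -> G (x, y) = g (x / y)) ->
  expect gM gE rho G = (\int[mu]_(t in nng) (g t * ratio_pdf gE gM rho t)%:E)%E.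
Proof.
move=> mG G0 mg g0 GE; rewrite expect_nng_pos//.
pose u (z : R * R) := z.2 * (g z.1 * pdf (z.2 * z.1, z.2)).
have mpdf := measurable_corr_pdf.
have umeas : measurable_fun setT u.
  apply: measurable_funM => //; apply: measurable_funM.
    exact: measurableT_comp.
  apply: measurableT_comp => //; apply: measurable_fun_pair => //.
  exact: measurable_funM.
have u0 z : (nng `*` pos) z -> (0 <= (u z)%:E)%E.
  move=> [/=]; rewrite !in_itv/= !andbT => t0 /ltW y0.
  by rewrite lee_fin mulr_ge0// mulr_ge0 ?g0// corr_pdf_ge0.
have mposR : measurable pos by exact: measurable_itv.
have mnngR : measurable nng by exact: measurable_itv.
rewrite fubini_tonelli2_setX//; last 2 first.
- apply/measurable_EFinP/measurable_funM; last exact: measurable_funTS.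
  exact: measurable_funS measurable_quadrant nng_pos_quadrant mG.
- by move=> z /nng_pos_quadrant Qz; rewrite lee_fin mulr_ge0 ?G0 ?corr_pdf_ge0.
transitivity (\int[mu]_(y in pos) \int[mu]_(t in nng) (u (t, y))%:E)%E.
  apply: eq_integral => y; rewrite inE/= in_itv/= andbT => y0.
  have mGp : measurable_fun setT (fun x : R => g (x / y) * pdf (x, y)).
    apply: measurable_funM; last exact: measurableT_comp.
    by apply: measurableT_comp => //; exact: measurable_funM.
  have mGy : measurable_fun setT (fun t : R => g (y * t / y) * pdf (y * t, y)).
    have my : measurable_fun setT (fun t : R => y * t) by exact: measurable_funM.
    exact: measurableT_comp mGp my.
  transitivity (\int[mu]_(x in nng) (g (x / y) * pdf (x, y))%:E)%E.
    by apply: eq_integral => x; rewrite inE/= in_itv/= andbT => x0; rewrite GE.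
  rewrite (ge0_integral_scale y y0); last 2 first.
  - by apply/measurable_EFinP; exact: measurable_funTS mGp.
  - move=> x x0; rewrite lee_fin; apply: mulr_ge0; last exact: corr_pdf_ge0.
    by apply: g0; rewrite divr_ge0 ?(ltW y0).
  rewrite -ge0_integralZl_EFin//; last 3 first.
  - move=> t; rewrite /= in_itv/= andbT => t0.
    rewrite lee_fin; apply: mulr_ge0; last exact: corr_pdf_ge0.
    by apply: g0; rewrite divr_ge0 ?mulr_ge0 ?(ltW y0).
  - by apply/measurable_EFinP; exact: measurable_funTS mGy.
  - exact: ltW.
  apply: eq_integral => t; rewrite inE/= in_itv/= andbT => t0.
  by rewrite -EFinM /u/= (mulrAC y t) divff ?mul1r// gt_eqF.
(* Exchange the order of integration: from here [y] is integrated at a fixed ratio [t]. *)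
rewrite -(fubini_tonelli2_setX nng pos (EFin \o u))//; last first.
  exact/measurable_EFinP/measurable_funTS.
rewrite fubini_tonelli1_setX//; last first.
  exact/measurable_EFinP/measurable_funTS.
apply: eq_integral => t; rewrite inE/= in_itv/= andbT => t0.
pose v y := y * expR (- (A t * y)) * besselI0 (B t * y).
have mv : measurable_fun setT v.
  apply: measurable_funM; last first.
    by apply: measurableT_comp; [exact: measurable_besselI0|exact: measurable_funM].
  apply: measurable_funM => //; apply: measurableT_comp => //.
  by apply: measurableT_comp => //; exact: measurable_funM.
have k0 : 0 <= g t * (gM * gE * (1 - rho))^-1.
  by rewrite mulr_ge0 ?g0// invr_ge0 !mulr_ge0// ltW.
transitivity (\int[mu]_(y in pos)
    ((g t * (gM * gE * (1 - rho))^-1)%:E * (v y)%:E))%E.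
  apply: eq_integral => y; rewrite inE/= in_itv/= andbT => /ltW y0.
  by rewrite /u/= corr_pdf_ray// -EFinM /v; congr EFin; ring.
rewrite ge0_integralZl_EFin//; last 2 first.
- move=> y /=; rewrite in_itv/= andbT => /ltW y0.
  by rewrite lee_fin mulr_ge0 ?besselI0_ge0// mulr_ge0// expR_ge0.
- exact/measurable_EFinP/measurable_funTS.
rewrite integral_itv_obnd_cbnd; last exact/measurable_EFinP/measurable_funTS.
rewrite integral_mul_expR_besselI0 ?BA// -EFinM -ratio_pdfE//.
by congr EFin; ring.
Qed.

End ratio_law.

(** * Pointwise bounds, convergence and measurability of the secrecy rate *)

Section capacity.
Context {R : realType}.
Local Notation mu := (@lebesgue_measure R).
Local Notation pos := (`]0%R, +oo[%classic : set R).
Local Notation nng := (`[0%R, +oo[%classic : set R).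
Variables (b : R) (b1 : 1 < b).

Let lnb0 : 0 < ln b. Proof. exact: ln_gt0. Qed.

Lemma ler_logb x y : 0 < x -> x <= y -> logb b x <= logb b y.
Proof.
by move=> x0 xy; rewrite ler_pM2r ?invr_gt0// ler_ln ?posrE// (lt_le_trans x0).
Qed.

Lemma logb_div x y : 0 < x -> 0 < y -> logb b (x / y) = logb b x - logb b y.
Proof. by move=> x0 y0; rewrite /logb ln_div ?posrE// mulrBl. Qed.

Lemma logb_ge0 x : 1 <= x -> 0 <= logb b x.
Proof. by move=> x1; rewrite divr_ge0 ?ln_ge0// ltW. Qed.

Section pointwise.
Variables (x y : R) (x0 : 0 <= x) (y0 : 0 <= y).

Lemma secrecy_rate_ge0 (P : R * R -> R) : 0 <= P (x, y) ->
  0 <= secrecy_rate b P (x, y).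
Proof.
move=> P0; rewrite /secrecy_rate/=; case: ifPn => // yx.
rewrite subr_ge0; apply: ler_logb; first by rewrite ltr_pwDl// mulr_ge0.
by rewrite lerD2l ler_wpM2r// ltW.
Qed.

Lemma secrecy_rateE (P : R * R -> R) : 0 <= P (x, y) ->
  secrecy_rate b P (x, y) =
  if y < x then logb b ((1 + x * P (x, y)) / (1 + y * P (x, y))) else 0.
Proof.
move=> P0; rewrite /secrecy_rate/=; case: ifPn => // yx.
by rewrite logb_div// ltr_pwDl// mulr_ge0.
Qed.

(** Cross-multiplying leaves [0 <= (x - y) * (q - p)]. This is the monotonicity required by monotone
    convergence. *)
Lemma secrecy_rate_le_cst (p q : R) : 0 <= p -> p <= q ->
  secrecy_rate b (cst p) (x, y) <= secrecy_rate b (cst q) (x, y).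
Proof.
move=> p0 pq; have q0 := le_trans p0 pq.
rewrite !secrecy_rateE//; case: ifPn => //= yx.
have [xp yp yq] : [/\ 0 < 1 + x * p, 0 < 1 + y * p & 0 < 1 + y * q].
  by rewrite !ltr_pwDl ?mulr_ge0.
apply: ler_logb; first exact: divr_gt0.
rewrite ler_pdivrMr// mulrAC ler_pdivlMr//; nra.
Qed.

(** Cross-multiplying leaves [y <= x]. At [y = 0] the bound would fail, since the default values
    make [lim_integrand] zero there while the rate can be positive. *)
Lemma secrecy_rate_le_lim (P : R * R -> R) : 0 < y -> 0 <= P (x, y) ->
  secrecy_rate b P (x, y) <= lim_integrand b (x, y).
Proof.
move=> y1 P0; rewrite secrecy_rateE// /lim_integrand/=; case: ifPn => //= yx.
have [xp yp] : 0 < 1 + x * P (x, y) /\ 0 < 1 + y * P (x, y).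
  by rewrite !ltr_pwDl ?mulr_ge0.
apply: ler_logb; first exact: divr_gt0.
rewrite ler_pdivrMr// mulrAC ler_pdivlMr//; nra.
Qed.

Lemma cvg_secrecy_rate : 0 < y ->
  secrecy_rate b (cst n.+1%:R) (x, y) @[n --> \oo] --> lim_integrand b (x, y).
Proof.
move=> y1; rewrite /lim_integrand/=; case: ifPn => yx; last first.
  rewrite (_ : (fun n => _) = cst 0); first exact: cvg_cst.
  by apply/funext => n; rewrite secrecy_rateE//= (negbTE yx).
(* Dividing numerator and denominator by the power [n.+1] leaves only the harmonic sequence to pass
   to the limit. *)
rewrite (_ : (fun n => _) = fun n => logb b ((n.+1%:R^-1 + x) / (n.+1%:R^-1 + y))).
  have ch (z : R) : ((n.+1%:R^-1 : R) + z) @[n --> \oo] --> z.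
    rewrite -[X in _ --> X]add0r; apply: cvgD; last exact: cvg_cst.
    exact: cvg_harmonic.
  apply: cvgM; last exact: cvg_cst.
  have cq : ((n.+1%:R^-1 + x) / (n.+1%:R^-1 + y)) @[n --> \oo] --> x / y.
    by apply: cvgM; [exact: ch|apply: cvgV; [rewrite gt_eqF|exact: ch]].
  by apply: cvg_comp cq _; apply: continuous_ln; rewrite divr_gt0// (lt_trans y1).
apply/funext => n; rewrite secrecy_rateE//= yx; congr logb.
by field; rewrite !gt_eqF ?ltr_pwDl ?mulr_ge0.
Qed.

End pointwise.

Lemma lim_integrand_ge0 (h : R * R) : quadrant h -> 0 <= lim_integrand b h.
Proof.
case: h => x y [/=]; rewrite !in_itv/= !andbT => x0 y0.
rewrite /lim_integrand/=; case: ifPn => // yx.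
have [->|yN0] := eqVneq y 0; first by rewrite invr0 mulr0 /logb ln0// mul0r.
by rewrite logb_ge0// ler_pdivlMr ?mul1r ?lt_neqAle ?y0 1?eq_sym ?yN0// ltW.
Qed.

Lemma measurable_lt_fst_snd : measurable_fun setT (fun h : R * R => h.2 < h.1).
Proof. exact: measurable_fun_ltr. Qed.

Lemma measurable_logb : measurable_fun setT (@logb R b).
Proof. by apply: measurable_funM => //; exact: measurable_ln. Qed.

Lemma measurable_secrecy_rate (P : R * R -> R) : measurable_fun setT P ->
  measurable_fun setT (secrecy_rate b P).
Proof.
move=> mP; apply: measurable_fun_ifT => //; first exact: measurable_lt_fst_snd.
apply: measurable_funB; apply: measurableT_comp => //; try exact: measurable_logb.
  by apply: measurable_funD => //; exact: measurable_funM.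
by apply: measurable_funD => //; exact: measurable_funM.
Qed.

Lemma measurable_lim_integrand : measurable_fun (@quadrant R) (lim_integrand b).
Proof.
(* A difference of logarithms replaces the logarithm of the quotient, and the guard [0 < h.2]
   reproduces the default value [0] on the axis. *)
apply: (eq_measurable_fun (fun h : R * R => if h.2 < h.1 then
   (if 0 < h.2 then logb b h.1 - logb b h.2 else 0) else 0)).
  move=> [x y]; rewrite inE => -[/=]; rewrite !in_itv/= !andbT => x0 y0.
  rewrite /lim_integrand/=; case: ifPn => // yx; case: ifPn => [y1|].
    by rewrite logb_div// (lt_trans y1).
  rewrite -leNgt => y1; rewrite (_ : y = 0); last by apply/eqP; rewrite eq_le y1.
  by rewrite invr0 mulr0 /logb ln0// mul0r.
apply: measurable_funTS; apply: measurable_fun_ifT => //.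
  exact: measurable_lt_fst_snd.
apply: measurable_fun_ifT => //; first exact: measurable_fun_ltr.
by apply: measurable_funB; apply: measurableT_comp => //; exact: measurable_logb.
Qed.

End capacity.

(** * Closed form of the limit, and the two inequalities for the capacity *)

Section main.
Context {R : realType}.
Local Notation mu := (@lebesgue_measure R).
Local Notation pos := (`]0%R, +oo[%classic : set R).
Local Notation nng := (`[0%R, +oo[%classic : set R).
Variables (b gM gE rho : R) (b1 : 1 < b).
Hypotheses (gM0 : 0 < gM) (gE0 : 0 < gE) (rho0 : 0 <= rho) (rho1 : rho < 1).
Local Notation pdf := (corr_pdf gM gE rho).
Local Notation p := (ratio_pdf gE gM rho).

Lemma measurable_ratio_pdf : measurable_fun nng p.
Proof.
apply: subspace_continuous_measurable_fun; first exact: measurable_itv.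
apply: continuous_in_subspaceT => t /set_mem/=; rewrite in_itv/= andbT.
exact: continuous_ratio_pdf.
Qed.

(** A constant is a function of the ratio, whose density has mass one. Hence the constant allocation
    [k] spends exactly the budget [k]. *)
Lemma expect_cst k : 0 <= k -> expect gM gE rho (cst k) = k%:E.
Proof.
move=> k0; rewrite (expect_ratio _ _ _ gM0 gE0 rho0 rho1 _ (cst k))//.
under eq_integral do rewrite EFinM.
rewrite ge0_integralZl_EFin//=.
- by rewrite integral_ratio_pdf// mule1.
- move=> t; rewrite /= in_itv/= andbT => t0.
  by rewrite lee_fin ratio_pdf_ge0.
- by apply/measurable_EFinP; exact: measurable_ratio_pdf.
Qed.

Lemma expect_lim_integrand : expect gM gE rho (lim_integrand b) =
  (logb b ((gE + gM + Num.sqrt ((gE + gM) ^+ 2 - 4 * rho * gE * gM)) /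
     (2 * gE)))%:E.
Proof.
have lnb0 : 0 < ln b by exact: ln_gt0.
pose g (t : R) := if 1 < t then logb b t else 0.
have limE (x y : R) : 0 <= x -> 0 < y -> lim_integrand b (x, y) = g (x / y).
  by move=> x0 y0; rewrite /lim_integrand /g/= ltr_pdivlMr// mul1r.
rewrite (expect_ratio _ _ _ gM0 gE0 rho0 rho1 _ g)//; last 4 first.
- exact: measurable_lim_integrand.
- exact: lim_integrand_ge0.
- apply: measurable_fun_ifT => //; first exact: measurable_fun_ltr.
  exact: measurable_logb.
- by move=> t t0; rewrite /g; case: ifPn => // t1; rewrite logb_ge0// ltW.
(* The strict cut [1 < t] becomes a closed half-line without changing the integrand, because
   [ln 1 = 0]. *)
transitivity (\int[mu]_(t in `[1%R, +oo[) ((ln b)^-1%:E * (ln t * p t)%:E))%E.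
  rewrite [LHS]integral_mkcond [RHS]integral_mkcond; apply: eq_integral => t _.
  rewrite !patchE !mem_setE !in_itv/= !andbT /g.
  case: (ltgtP 1 t) => [t1|t1|<-].
  - rewrite (ltW (lt_trans ltr01 t1)) -EFinM; congr EFin.
    by rewrite /logb; ring.
  - by case: ifPn => // _; rewrite mul0r.
  - by rewrite ler01 ln1 !mul0r mule0.
rewrite ge0_integralZl_EFin//; last 3 first.
- move=> t; rewrite /= in_itv/= andbT => t1.
  by rewrite lee_fin mulr_ge0 ?ln_ge0// ratio_pdf_ge0// (le_trans ler01).
- apply/measurable_EFinP/measurable_funM.
    by apply: measurable_funTS; exact: measurable_ln.
  apply: measurable_funS measurable_ratio_pdf; first exact: measurable_itv.
  by move=> t/=; rewrite !in_itv/= !andbT; exact: le_trans.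
- by rewrite invr_ge0 ltW.
by rewrite integral_ln_ratio_pdf// -EFinM mulrC.
Qed.

(** The two logarithms merge into one. The radicand on the right is [ratio_disc gE gM rho 1] over
    [(2 * (gE + gM)) ^+ 2], so the square root splits by positivity of the discriminant. *)
Lemma logb_limitE (kappa := gM / gE) :
  logb b ((gE + gM + Num.sqrt ((gE + gM) ^+ 2 - 4 * rho * gE * gM)) / (2 * gE)) =
  logb b (1 + kappa)
    + logb b (2^-1 + Num.sqrt (4^-1 - rho * kappa / (1 + kappa) ^+ 2)).
Proof.
have k0 : 0 < 1 + kappa by rewrite addr_gt0// divr_gt0.
have s0 : 0 < gE + gM by exact: addr_gt0.
set y := 2^-1 + _; have y0 : 0 < y by rewrite ltr_pwDl ?sqrtr_ge0 ?invr_gt0.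
rewrite /logb -[RHS]mulrDl -lnM ?posrE//; congr (ln _ / _); rewrite /y.
have -> : 4^-1 - rho * kappa / (1 + kappa) ^+ 2 =
    ((gE + gM) ^+ 2 - 4 * rho * gE * gM) / (2 * (gE + gM)) ^+ 2.
  rewrite /kappa; field.
  by rewrite !gt_eqF.
rewrite sqrtrM; last first.
  have := ratio_disc_gt0 gE gM rho gE0 gM0 rho0 rho1 1 ler01.
  by rewrite /ratio_disc !mulr1 => /ltW.
rewrite sqrtrV ?sqr_ge0// sqrtr_sqr ger0_norm; last by rewrite mulr_ge0// ltW.
by rewrite /kappa; field; rewrite !gt_eqF.
Qed.

(** A larger budget admits more allocations. The limit at infinity is therefore the supremum over
    all budgets, and convergence reduces to two inequalities. *)
Lemma secrecy_capacity_nondecreasing :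
  nondecreasing_fun (secrecy_capacity b gM gE rho).
Proof.
move=> P1 P2 P12; apply: le_ereal_sup => _ [P [mP [P0 PP]] <-].
by exists P => //; split => //; split => //; apply: le_trans PP _; rewrite lee_fin.
Qed.

Lemma quadrant_ge0 (h : R * R) : quadrant h -> 0 <= h.1 /\ 0 <= h.2.
Proof. by case: h => x y [/=]; rewrite !in_itv/= !andbT. Qed.

Lemma expect_secrecy_rateE (P : R * R -> R) :
  measurable_fun setT P -> (forall h, 0 <= P h) ->
  expect gM gE rho (secrecy_rate b P) =
  (\int[mu \x mu]_(h in nng `*` pos) (secrecy_rate b P h * pdf h)%:E)%E.
Proof.
move=> mP P0; apply: expect_nng_pos => //.
  by apply: measurable_funTS; exact: measurable_secrecy_rate.
by case=> x y /quadrant_ge0[/= x0 y0]; exact: secrecy_rate_ge0.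
Qed.

Lemma expect_lim_integrandE :
  expect gM gE rho (lim_integrand b) =
  (\int[mu \x mu]_(h in nng `*` pos) (lim_integrand b h * pdf h)%:E)%E.
Proof.
apply: expect_nng_pos => //; first exact: measurable_lim_integrand.
exact: lim_integrand_ge0.
Qed.

Lemma secrecy_capacity_le_lim Pbar :
  (secrecy_capacity b gM gE rho Pbar <= expect gM gE rho (lim_integrand b))%E.
Proof.
apply: ge_ereal_sup => _ [P [mP [P0 _]] <-].
rewrite expect_secrecy_rateE// expect_lim_integrandE.
have mpdf : measurable_fun (nng `*` pos) pdf.
  by apply: measurable_funTS; exact: measurable_corr_pdf.
apply: ge0_le_integral; first exact: measurable_nng_pos.
- case=> x y /nng_pos_quadrant /quadrant_ge0[/= x0 y0].
  by rewrite lee_fin mulr_ge0 ?corr_pdf_ge0// secrecy_rate_ge0.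
- apply/measurable_EFinP/measurable_funM => //.
  by apply: measurable_funTS; exact: measurable_secrecy_rate.
- apply/measurable_EFinP/measurable_funM => //.
  have mlim := measurable_lim_integrand b.
  exact: measurable_funS measurable_quadrant nng_pos_quadrant mlim.
- case=> x y [/=]; rewrite !in_itv/= !andbT => x0 y0.
  rewrite lee_fin ler_wpM2r ?corr_pdf_ge0// secrecy_rate_le_lim//; exact: ltW.
Qed.

Lemma expect_lim_integrand_le :
  (expect gM gE rho (lim_integrand b) <=
   ereal_sup (range (secrecy_capacity b gM gE rho)))%E.
Proof.
pose f (n : nat) (h : R * R) := (secrecy_rate b (cst n.+1%:R) h * pdf h)%:E.
have fE n : (\int[mu \x mu]_(h in nng `*` pos) f n h =
    expect gM gE rho (secrecy_rate b (cst n.+1%:R)))%E.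
  by rewrite expect_secrecy_rateE.
have mpdf : measurable_fun (nng `*` pos) pdf.
  by apply: measurable_funTS; exact: measurable_corr_pdf.
have cvgf : (\int[mu \x mu]_(h in nng `*` pos) f n h)%E @[n --> \oo] -->
    (\int[mu \x mu]_(h in nng `*` pos) limn (f ^~ h))%E.
  apply: cvg_monotone_convergence; first exact: measurable_nng_pos.
  - move=> n; apply/measurable_EFinP/measurable_funM => //.
    by apply: measurable_funTS; exact: measurable_secrecy_rate.
  - move=> n [x y] /nng_pos_quadrant /quadrant_ge0[/= x0 y0].
    by rewrite lee_fin mulr_ge0 ?corr_pdf_ge0// secrecy_rate_ge0.
  - move=> [x y] /nng_pos_quadrant /quadrant_ge0[/= x0 y0] m n mn.
    by rewrite lee_fin ler_wpM2r ?corr_pdf_ge0// secrecy_rate_le_cst// ler_nat.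
have -> : expect gM gE rho (lim_integrand b) =
    (\int[mu \x mu]_(h in nng `*` pos) limn (f ^~ h))%E.
  rewrite expect_lim_integrandE; apply: eq_integral => -[x y].
  rewrite inE => -[/=]; rewrite !in_itv/= !andbT => x0 y0.
  apply/esym/cvg_lim => //; apply: cvg_EFin; first exact: nearW.
  by apply: cvgM; [apply: cvg_secrecy_rate => //; exact: ltW|exact: cvg_cst].
(* It suffices to bound each term: the constant allocation [n.+1] is admissible for the budget
   [n.+1], so its expected rate is at most the capacity there. *)
rewrite -(cvg_lim _ cvgf)//; apply: lime_le; first exact: cvgP cvgf.
apply: nearW => n; rewrite fE.
apply: (@le_trans _ _ (secrecy_capacity b gM gE rho n.+1%:R)).
  apply: ereal_sup_ubound; exists (cst n.+1%:R) => //.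
  by split => //; split => //; rewrite expect_cst.
by apply: ereal_sup_ubound; exists n.+1%:R.
Qed.

End main.

Theorem theorem2 (R : realType) (b gM gE rho : R)
  (hb : 1 < b) (hgM : 0 < gM) (hgE : 0 < gE) (hrho0 : 0 <= rho) (hrho1 : rho < 1) :
  let kappa := gM / gE in
  (secrecy_capacity b gM gE rho Pbar @[Pbar --> +oo]
     --> expect gM gE rho (lim_integrand b)) /\
  expect gM gE rho (lim_integrand b)
    = (logb b (1 + kappa)
       + logb b (2^-1 + Num.sqrt (4^-1 - rho * kappa / (1 + kappa) ^+ 2)))%:E.
Proof.
move=> kappa; split; last by rewrite expect_lim_integrand// logb_limitE.
have -> : expect gM gE rho (lim_integrand b) =
    ereal_sup (range (secrecy_capacity b gM gE rho)).
  apply/eqP; rewrite eq_le expect_lim_integrand_le//=.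
  by apply: ge_ereal_sup => _ [Pbar _ <-]; exact: secrecy_capacity_le_lim.
by apply: nondecreasing_cvge; exact: secrecy_capacity_nondecreasing.
Qed.
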